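(* Let $(\mathcal{L},\circ_\lambda,[\cdot_\lambda\cdot])$ be a transposed Poisson conformal algebra. For any $h\in\mathcal{L}$, define a new operation $[\cdot_\lambda\cdot]^h$ on $\mathcal{L}$ by $$[x_\lambda y]^h:=(h\circ_\mu[x_\lambda y])|_{\mu=0},\qquad x,y\in\mathcal{L}.$$ Then $(\mathcal{L},\circ_\lambda,[\cdot_\lambda\cdot]^h)$ is a transposed Poisson conformal algebra.
   Context: All vector spaces, linear maps and tensor products are over $\mathbb{C}$. For a vector space $A$, $A[\lambda]$ denotes polynomials in $\lambda$ with coefficients in $A$. A conformal algebra $(A,\circ_\lambda)$ is a $\mathbb{C}[\partial]$-module $A$ with a $\mathbb{C}$-bilinear map $A\otimes A\to A[\lambda]$, $a\otimes b\mapsto a\circ_\lambda b$, such that $(\partial a)\circ_\lambda b=-\lambda\, a\circ_\lambda b$ and $a\circ_\lambda(\partial b)=(\partial+\lambda)(a\circ_\lambda b)$. Convention: products are extended linearly to polynomials in formal variables (so $h\circ_\mu[x_\lambda y]$ is computed coefficientwise in $\lambda$). If $a\circ_\lambda b=\sum_n\lambda^n w_n$ and $\nu$ is a linear combination of formal variables, then $a\circ_{-\partial+\nu}b=\sum_n(-\partial+\nu)^n w_n$; the same convention applies to $[a_\lambda b]$. A commutative associative conformal algebra is a conformal algebra with $a\circ_\lambda(b\circ_\mu c)=(a\circ_\lambda b)\circ_{\lambda+\mu}c$ and $a\circ_\lambda b=b\circ_{-\partial-\lambda}a$ for all $a,b,c$. A Lie conformal algebra $(A,[\cdot_\lambda\cdot])$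 is a conformal algebra (with product written $[a_\lambda b]$) such that $[a_\lambda b]=-[b_{-\lambda-\partial}a]$ and $[a_\lambda[b_\mu c]]=[[a_\lambda b]_{\lambda+\mu}c]+[b_\mu[a_\lambda c]]$ for all $a,b,c$. A transposed Poisson conformal algebra (TPCA) is a $\mathbb{C}[\partial]$-module $\mathcal{L}$ with $\mathbb{C}$-bilinear maps $\circ_\lambda,[\cdot_\lambda\cdot]:\mathcal{L}\otimes\mathcal{L}\to\mathcal{L}[\lambda]$ such that $(\mathcal{L},\circ_\lambda)$ is a commutative associative conformal algebra, $(\mathcal{L},[\cdot_\lambda\cdot])$ is a Lie conformal algebra, and $2(a\circ_\lambda[b_\mu c])=[(a\circ_\lambda b)_{\lambda+\mu}c]+[b_\mu(a\circ_\lambda c)]$ for all $a,b,c\in\mathcal{L}$. *)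

(* Defs.v *)
From HB Require Import structures.
From mathcomp Require Import all_boot all_order all_algebra finmap.
From mathcomp Require Import monalg complex reals.

Set Implicit Arguments.
Unset Strict Implicit.
Unset Printing Implicit Defensive.

Import GRing.Theory.
Local Open Scope ring_scope.

(* [polymod A] is A[X], the finitely supported families of coefficients in    *)
(* the K-module A.  It is a module over K[X] = {poly K}; iterating the        *)
(* construction, A[X][Y] is a module over K[X][Y] = {poly {poly K}}.          *)
Definition polymod (K : nzRingType) (A : lmodType K) : Type := {malg A[nat]}.

Section PolyModule.
Context (K : nzRingType) (A : lmodType K).
Implicit Types (p q : {poly K}) (f g : polymod A).

HB.instance Definition _ := GRing.Zmodule.on (polymod A).

Definition polymod_scale p f : polymod A :=
  \sum_(k <- msupp f) \sum_(i < size p)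
    << p`_i *: f@_k *g (i + k)%N >>.

Lemma polymod_scaleE p f n :
  (polymod_scale p f)@_n = \sum_(i < n.+1) p`_i *: f@_(n - i)%N.
Proof.
rewrite /polymod_scale exchange_big /= (@raddf_sum _ _ (mcoeff n)).
transitivity (\sum_(i < size p | (i < n.+1)%N) p`_i *: f@_(n - i)%N); last first.
  rewrite (big_ord_widen_cond (maxn (size p) n.+1) (fun i => i < n.+1)%N
    (fun i => p`_i *: f@_(n - i)%N)) ?leq_maxl //.
  rewrite [RHS](big_ord_widen (maxn (size p) n.+1)
    (fun i => p`_i *: f@_(n - i)%N)) ?leq_maxr //.
  rewrite big_mkcond [RHS]big_mkcond; apply: eq_bigr => i _ /=.
  rewrite andbC; case: (ltnP i (size p)) => //= le_pi.
  by rewrite nth_default // scale0r if_same.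
rewrite [RHS]big_mkcond; apply: eq_bigr => i _.
rewrite raddf_sum /=; under eq_bigr do rewrite mcoeffU.
rewrite ltnS; case: leqP => [le_in|lt_ni]; last first.
  apply: big1 => k _; case: eqP => // ikn.
  by move: lt_ni; rewrite -ikn ltnNge leq_addr.
under eq_bigr => k _ do rewrite -{1}(subnKC le_in) eqn_add2l.
case: (msuppP f (n - i)%N) => [nf|nf]; last first.
  rewrite scaler0 big_seq big1 // => k kf; case: eqP => // kn.
  by move: nf; rewrite -kn kf.
rewrite (bigD1_seq (n - i)%N) ?fset_uniq //= eqxx mulr1n big1 ?addr0 //.
by move=> k /negbTE->.
Qed.

Lemma polymod_scaleE_rev p f n :
  (polymod_scale p f)@_n = \sum_(i < n.+1) p`_(n - i)%N *: f@_(i : nat).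
Proof.
rewrite polymod_scaleE (reindex_inj rev_ord_inj) /=.
by apply: eq_bigr => i _; rewrite subSS subKn // -ltnS.
Qed.

Fact polymod_scaleA p q f :
  polymod_scale p (polymod_scale q f) = polymod_scale (p * q) f.
Proof.
apply/malgP => n; rewrite polymod_scaleE polymod_scaleE_rev.
pose F (j k : nat) : A := (p`_j * q`_(n - j - k)%N) *: f@_k.
transitivity (\sum_(j < n.+1) \sum_(k < n.+1 | (k <= n - j)%N) F j k).
  apply: eq_bigr => /= j _; rewrite polymod_scaleE_rev scaler_sumr.
  rewrite (big_ord_narrow_leq (leq_subr _ _)) /=.
  by apply: eq_bigr => k _; rewrite scalerA.
rewrite (exchange_big_dep predT) //=; apply: eq_bigr => k _.
transitivity (\sum_(j < n.+1 | (j <= n - k)%N) F j k).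
  apply: eq_bigl => j; rewrite -ltnS -(ltnS j) -!subSn ?leq_ord //.
  by rewrite -subn_gt0 -(subn_gt0 j) -!subnDA addnC.
rewrite (big_ord_narrow_leq (leq_subr _ _)) coefM scaler_suml /=.
by apply: eq_bigr => j _; rewrite /F -!subnDA addnC.
Qed.

Fact polymod_scale1 : left_id 1 polymod_scale.
Proof.
move=> f; apply/malgP => n; rewrite polymod_scaleE big_ord_recl subn0.
rewrite coef1 scale1r big1 ?addr0 // => i _.
by rewrite coef1 scale0r.
Qed.

Fact polymod_scaleDr : right_distributive polymod_scale +%R.
Proof.
move=> p f g; apply/malgP => n; rewrite mcoeffD !polymod_scaleE -big_split /=.
by apply: eq_bigr => i _; rewrite mcoeffD scalerDr.
Qed.

Fact polymod_scaleDl f : {morph polymod_scale^~ f : p q / p + q}.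
Proof.
move=> p q; apply/malgP => n; rewrite mcoeffD !polymod_scaleE -big_split /=.
by apply: eq_bigr => i _; rewrite coefD scalerDl.
Qed.

HB.instance Definition _ := GRing.Zmodule_isLmodule.Build {poly K} (polymod A)
  polymod_scaleA polymod_scale1 polymod_scaleDr polymod_scaleDl.

End PolyModule.

(* For p = \sum_n X^n w_n, [psubst nu f p] is \sum_n nu^n f(w_n).             *)
Definition psubst (K S : nzRingType) (A : lmodType K) (M : lmodType S)
    (nu : S) (f : A -> M) (p : polymod A) : M :=
  \sum_(n <- msupp p) nu ^+ n *: f p@_n.

Definition pconst (K : nzRingType) (A : lmodType K) (a : A) : polymod A :=
  << a *g 0%N >>.

Section Conformal.
Context (F : fieldType).

(* F[del], F[del][lambda] and F[del][lambda][mu].  An F[del]-module is an     *)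
(* lmodType over [Fdel], c : F acting as c%:P and del as 'X.                  *)
Notation Fdel := {poly F}.
Notation Fdel1 := {poly Fdel}.
Notation Fdel2 := {poly Fdel1}.

Definition del : Fdel := 'X.
Definition del1 : Fdel1 := del%:P.
Definition lam1 : Fdel1 := 'X.
Definition lam2 : Fdel2 := lam1%:P.
Definition mu2 : Fdel2 := 'X.

Context (L : lmodType Fdel).

(* L[lambda] and L[lambda][mu] *)
Notation L1 := (polymod L).
Notation L2 := (polymod L1).
Implicit Types (op br : L -> L -> L1) (a b c h x y : L).

(* Substitution of nu for the variable of p, with values in L[lambda] and in  *)
(* L[lambda][mu] respectively.                                                *)
Definition psubst1 (nu : Fdel1) (p : L1) : L1 := psubst nu (@pconst _ L) p.
Definition psubst2 (nu : Fdel2) (p : L1) : L2 :=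
  psubst nu (fun w => pconst (pconst w)) p.

(* [nest_r op a nu rho p] is  a op_nu p(rho)  and [nest_l op rho p nu c] is   *)
(* p(rho) op_nu c, with op extended linearly to polynomial arguments.         *)
Definition nest_r op a (nu rho : Fdel2) (p : L1) : L2 :=
  psubst rho (fun w => psubst2 nu (op a w)) p.
Definition nest_l op (rho : Fdel2) (p : L1) (nu : Fdel2) c : L2 :=
  psubst rho (fun w => psubst2 nu (op w c)) p.

Record is_conformal op : Prop := {
  conformalDl : forall a a' b, op (a + a') b = op a b + op a' b;
  conformalDr : forall a b b', op a (b + b') = op a b + op a b';
  conformalZl : forall (k : F) a b, op (k%:P *: a) b = k%:P%:P *: op a b;
  conformalZr : forall (k : F) a b, op a (k%:P *: b) = k%:P%:P *: op a b;
  conformal_dell : forall a b, op (del *: a) b = - lam1 *: op a b;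
  conformal_delr : forall a b, op a (del *: b) = (del1 + lam1) *: op a b
}.

Record is_comm_assoc_conformal op : Prop := {
  comm_assoc_conformal : is_conformal op;
  conformalA : forall a b c,
    nest_r op a lam2 mu2 (op b c) = nest_l op lam2 (op a b) (lam2 + mu2) c;
  conformalC : forall a b, op a b = psubst1 (- del1 - lam1) (op b a)
}.

Record is_Lie_conformal br : Prop := {
  Lie_conformal : is_conformal br;
  Lie_skew : forall a b, br a b = - psubst1 (- lam1 - del1) (br b a);
  Lie_Jacobi : forall a b c,
    nest_r br a lam2 mu2 (br b c) =
    nest_l br lam2 (br a b) (lam2 + mu2) c + nest_r br b mu2 lam2 (br a c)
}.

Record is_TPCA op br : Prop := {
  TPCA_comm_assoc : is_comm_assoc_conformal op;
  TPCA_Lie : is_Lie_conformal br;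
  TPCA_compat : forall a b c,
    2%:R *: nest_r op a lam2 mu2 (br b c) =
    nest_l br lam2 (op a b) (lam2 + mu2) c + nest_r br b mu2 lam2 (op a c)
}.

(* h op_mu [x_lambda y] in L[lambda][mu], evaluated at mu = 0 *)
Definition bracket_by op br h x y : L1 :=
  psubst 0 (fun p : L1 => p) (nest_r op h mu2 lam2 (br x y)).

End Conformal.

(* Main.v *)
From HB Require Import structures.
Require Import Defs.
From mathcomp Require Import all_boot all_order all_algebra.
From mathcomp Require Import finmap monalg complex reals.
Import GRing.Theory.
Local Open Scope ring_scope.

Set Implicit Arguments.
Unset Strict Implicit.
Unset Printing Implicit Defensive.

(** Write [H x] for the coefficient of [lambda ^ 0] in [op h x].  Since
[op h (del *: x) = (del + lambda) *: op h x], the map [H] is linear over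
[F[del]], so it acts on polynomials coefficientwise ([pmap H]), commuting with
every substitution that occurs in the axioms; and the new bracket is
[pmap H (br x y)] ([bracket_byE]).  Only two more facts about [H] matter, both
obtained by setting [lambda = 0] in an axiom whose first argument is [h]:
- associativity and commutativity of [op] give
  [pmap H (op x y) = op x (H y)] ([op_zero_mode_r]);
- the compatibility axiom says that [H] is a half-derivation of the bracket,
  [2 pmap H (br x y) = br (H x) y + br x (H y)] ([br_zero_mode]).

Linearity makes the new bracket a skew-symmetric conformal product, and the
first fact makes it compatible with [op].  The Jacobi identity is the point
that needs an argument.  Omitting the formal variables, put
- [S = [a, H[b, c]] - [H[a, b], c] - [b, H[a, c]]],
- [T = [H a, [b, c]] - [[a, b], H c] - [H b, [a, c]]].
Applying [2 H] to the Jacobi identity of [a, b, c] gives [S + T = 0].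
Expanding [2 S] by the half-derivation rule and rewriting with the Jacobi
identities of [(H a, b, c)], [(a, H b, c)] and [(a, b, H c)] gives
[2 S = - T].  Hence [2 S = S], that is [S = 0] ([twisted_Jacobi]), and the
Jacobi identity of the new bracket is [H S = 0]. *)

(** * Coefficientwise maps of polynomial modules *)

Section CoefficientMap.
Context (K K' : nzRingType) (A : lmodType K) (B : lmodType K').

Definition pmap (f : A -> B) (p : polymod A) : polymod B :=
  \sum_(n <- msupp p) << f p@_n *g n >>.

Lemma pmapE (f : {additive A -> B}) p n : (pmap f p)@_n = f p@_n.
Proof.
rewrite /pmap (@raddf_sum _ _ (mcoeff n)) /=.
under eq_bigr do rewrite mcoeffU.
case: (msuppP p n) => [np|np].
  rewrite (bigD1_seq n) ?fset_uniq //= eqxx mulr1n big1 ?addr0 //.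
  by move=> k /negbTE->.
rewrite raddf0 big_seq big1 // => k kp; case: eqP => // kn.
by move: np; rewrite -kn kp.
Qed.

Lemma pmapD (f : {additive A -> B}) : {morph pmap f : p q / p + q}.
Proof. by move=> p q; apply/malgP => n; rewrite mcoeffD !pmapE mcoeffD raddfD. Qed.

Lemma pmap0 (f : {additive A -> B}) : pmap f 0 = 0.
Proof. by apply/malgP => n; rewrite pmapE !mcoeff0 raddf0. Qed.

HB.instance Definition _ (f : {additive A -> B}) :=
  GRing.isNmodMorphism.Build (polymod A) (polymod B) (pmap f)
    (conj (pmap0 f) (pmapD f)).

(** Two base rings are needed: extracting a coefficient changes the ring of
scalars, and it is semilinear along extraction of a coefficient of the
scalar. *)
Lemma pmapZ (s : {rmorphism K -> K'}) (f : {additive A -> B}) :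
    (forall c x, f (c *: x) = s c *: f x) ->
  forall P p, pmap f (P *: p) = map_poly s P *: pmap f p.
Proof.
move=> fZ P p; apply/malgP => n; rewrite pmapE !polymod_scaleE raddf_sum.
by apply: eq_bigr => i _; rewrite fZ coef_map pmapE.
Qed.

Lemma pmap_const (f : {additive A -> B}) a : pmap f (pconst a) = pconst (f a).
Proof. by apply/malgP => n; rewrite pmapE !mcoeffU raddfMn. Qed.

End CoefficientMap.

Section LinearCoefficientMap.
Context (K : nzRingType) (A B : lmodType K) (f : {linear A -> B}).

Fact pmap_scalable : scalable (pmap f).
Proof.
move=> P p; rewrite (@pmapZ _ _ _ _ idfun) ?map_poly_id //.
by move=> c x; exact: linearZZ.
Qed.

HB.instance Definition _ :=
  GRing.isScalable.Build {poly K} (polymod A) (polymod B) *:%R (pmap f)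
    pmap_scalable.

End LinearCoefficientMap.

Section Constants.
Context (K : nzRingType) (A : lmodType K).

Lemma pconst0 : pconst (0 : A) = 0.
Proof. by apply/malgP => n; rewrite mcoeffU mul0rn mcoeff0. Qed.

Lemma pconstD : {morph @pconst K A : x y / x + y}.
Proof. by move=> x y; apply/malgP => n; rewrite mcoeffD !mcoeffU mulrnDl. Qed.

HB.instance Definition _ :=
  GRing.isNmodMorphism.Build A (polymod A) (@pconst K A)
    (conj pconst0 pconstD).

Lemma mcoeff0Z (P : {poly K}) (p : polymod A) : (P *: p)@_0 = P`_0 *: p@_0.
Proof. by rewrite polymod_scaleE big_ord1. Qed.

End Constants.

(** * Substitution *)

Lemma morph_add0 (U V : zmodType) (f : U -> V) :
  {morph f : x y / x + y} -> f 0 = 0.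
Proof. by move=> fD; apply: (addIr (f 0)); rewrite -fD !add0r. Qed.

Section Substitution.
Context (K : nzRingType) (A : lmodType K).

Section Codomain.
Context (S : nzRingType) (M : lmodType S).
Implicit Types (nu : S) (f : A -> M) (p q : polymod A).

Lemma psubst_widen nu f (X : {fset nat}) p : f 0 = 0 ->
  (msupp p `<=` X)%fset -> psubst nu f p = \sum_(n <- X) nu ^+ n *: f p@_n.
Proof.
move=> f0 pX; apply: big_fset_incl => // n _ np.
by rewrite mcoeff_outdom // f0 scaler0.
Qed.

Lemma eq_psubst nu f g p : f =1 g -> psubst nu f p = psubst nu g p.
Proof. by move=> fg; apply: eq_bigr => n _; rewrite fg. Qed.

Lemma psubst_addl nu f g p :
  psubst nu (fun x => f x + g x) p = psubst nu f p + psubst nu g p.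
Proof. by rewrite -big_split; apply: eq_bigr => n _; rewrite scalerDr. Qed.

Lemma psubstD nu f :
  {morph f : x y / x + y} -> {morph psubst nu f : p q / p + q}.
Proof.
move=> fD p q; have f0 := morph_add0 fD.
rewrite (@psubst_widen _ _ (msupp p `|` msupp q)%fset) ?msuppD_le //.
rewrite (@psubst_widen _ _ (msupp p `|` msupp q)%fset p) ?fsubsetUl //.
rewrite (@psubst_widen _ _ (msupp p `|` msupp q)%fset q) ?fsubsetUr //.
by rewrite -big_split; apply: eq_bigr => n _; rewrite mcoeffD fD scalerDr.
Qed.

Lemma psubst_0 nu f : psubst nu f 0 = 0.
Proof. by rewrite /psubst msupp0 big_nil. Qed.

Lemma psubst_at0 f p : f 0 = 0 -> psubst 0 f p = f p@_0.
Proof.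
move=> f0; rewrite (@psubst_widen _ _ (0%N |` msupp p)%fset) ?fsubsetUr //.
rewrite (bigD1_seq 0%N) ?fset_uniq ?in_fset1U //= expr0 scale1r big1 ?addr0 //.
by move=> n /negbTE n0; rewrite expr0n n0 scale0r.
Qed.

Lemma psubst_semilinear (S' : nzRingType) (N : lmodType S')
    (s : {rmorphism S -> S'}) (G : {additive M -> N}) :
    (forall c x, G (c *: x) = s c *: G x) ->
  forall nu f p, G (psubst nu f p) = psubst (s nu) (G \o f) p.
Proof.
by move=> GZ nu f p; rewrite raddf_sum; apply: eq_bigr => n _; rewrite GZ rmorphXn.
Qed.

Lemma psubst_linear (N : lmodType S) (G : {linear M -> N}) nu f p :
  G (psubst nu f p) = psubst nu (G \o f) p.
Proof. by rewrite (@psubst_semilinear _ _ idfun) // => c x; exact: linearZZ. Qed.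

End Codomain.

Lemma psubst_var (p : polymod A) : psubst 'X (@pconst K A) p = p.
Proof.
apply/malgP => n; rewrite /psubst (@raddf_sum _ _ (mcoeff n)) /=.
have coefXpconst k (x : A) : ('X^k *: pconst x : polymod A)@_n = x *+ (k == n).
  rewrite polymod_scaleE_rev big_ord_recl big1 => [|i _]; last first.
    by rewrite mcoeffU mulr0n scaler0.
  by rewrite /= subn0 mcoeffU coefXn addr0 mulr1n eq_sym scaler_nat.
under eq_bigr do rewrite coefXpconst.
have := pmapE (idfun : {additive A -> A}) p n.
rewrite /pmap (@raddf_sum _ _ (mcoeff n)) /= => <-.
by apply: eq_bigr => k _; rewrite mcoeffU.
Qed.

End Substitution.

Lemma psubst_pmap (K K' S : nzRingType) (A : lmodType K) (B : lmodType K')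
    (M : lmodType S) (g : {additive A -> B}) (nu : S) (f : B -> M) p :
  f 0 = 0 -> psubst nu f (pmap g p) = psubst nu (f \o g) p.
Proof.
move=> f0; rewrite (@psubst_widen _ _ _ _ _ _ (msupp p)) //.
  by apply: eq_bigr => n _; rewrite pmapE.
apply/fsubsetP => n; rewrite -!mcoeff_neq0 pmapE.
by apply: contraNneq => ->; rewrite raddf0.
Qed.

(** * Conformal products *)

(** The linear algebra behind the Jacobi identity of a twisted bracket.
[A = B + C] is the Jacobi identity of [(a, b, c)] after [H]; [SA], [SB], [SC]
are its three terms with [H] moved to the inner bracket.  With
[S = SA - SB - SC] and [T = A1 - B2 - C1], the hypotheses give [S + T = 0] and
[2 S = - T], so that [S = 0] whatever the characteristic. *)
Lemma half_derivation_cancel (V : zmodType)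
    (A B C SA SB SC A1 B2 C1 P1 P2 Q1 Q2 R1 R2 : V) :
    A = B + C ->
    A *+ 2 = A1 + SA -> B *+ 2 = SB + B2 -> C *+ 2 = C1 + SC ->
    SA *+ 2 = P1 + P2 -> SB *+ 2 = Q1 + Q2 -> SC *+ 2 = R1 + R2 ->
    A1 = Q1 + R1 -> P1 = Q2 + C1 -> P2 = B2 + R2 ->
  SA = SB + SC.
Proof.
move=> -> ABC BE CE SA2 SB2 SC2 A1E P1E P2E.
have sum0 : A1 + SA = (SB + B2) + (C1 + SC) by rewrite -ABC mulrnDl BE CE.
(* The added summand makes the relations for 2 SA, 2 SB, 2 SC and S + T = 0
all applicable. *)
apply: (addIr (SA + A1 + Q2 + R2)).
transitivity (SA *+ 2 + (Q1 + Q2) + (R1 + R2)).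
  by rewrite A1E mulr2n !addrA (ACl (1*2*3*5*4*6)).
transitivity (SB + SC + (A1 + SA) + Q2 + R2).
  rewrite SA2 -SB2 -SC2 sum0 P1E P2E !mulr2n !addrA.
  by rewrite [LHS](ACl (5*7*6*3*2*8*1*4)).
by rewrite (addrC A1) !addrA.
Qed.

Section Nesting.
Context (F : fieldType) (L : lmodType {poly F}).
Notation L1 := (polymod L).
Notation L2 := (polymod L1).
Notation Fdel1 := {poly {poly F}}.
Notation Fdel2 := {poly Fdel1}.
Implicit Types (op br : L -> L -> L1) (a b c x : L) (p q : L1) (nu rho : Fdel2).

Lemma psubst2D nu : {morph @psubst2 F L nu : p q / p + q}.
Proof. by apply: psubstD => x y; rewrite !raddfD. Qed.

Lemma conformal_r0 op a : is_conformal op -> op a 0 = 0.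
Proof. by move=> opC; apply: (@morph_add0 _ _ (op a)) => x y; exact: conformalDr. Qed.

Lemma conformal_l0 op c : is_conformal op -> op 0 c = 0.
Proof. by move=> opC; apply: (@morph_add0 _ _ (op^~ c)) => x y; exact: conformalDl. Qed.

Lemma nest_rD op a nu rho : is_conformal op ->
  {morph nest_r op a nu rho : p q / p + q}.
Proof. by move=> opC; apply: psubstD => x y; rewrite (conformalDr opC) psubst2D. Qed.

Lemma nest_lD op rho nu c : is_conformal op ->
  {morph (fun p => nest_l op rho p nu c) : p q / p + q}.
Proof. by move=> opC; apply: psubstD => x y; rewrite (conformalDl opC) psubst2D. Qed.

Lemma psubst1_at0 p : psubst1 0 p = pconst p@_0.
Proof. by apply: psubst_at0; rewrite raddf0. Qed.

(** Setting one of the two variables to zero turns an axiom in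
[L[lambda][mu]] into an identity in [L[lambda]].  Both evaluations, at
[lambda = 0] and at [mu = 0], are semilinear maps fixing constants, which is
all that is used to push them through the nested products. *)
Section Evaluation.
Context (s : {rmorphism Fdel2 -> Fdel1}) (G : {additive L2 -> L1}).
Hypothesis GZ : forall k u, G (k *: u) = s k *: G u.
Hypothesis G_const : forall w, G (pconst (pconst w)) = pconst w.

Lemma psubst2_eval nu p : G (psubst2 nu p) = psubst1 (s nu) p.
Proof. by rewrite (psubst_semilinear GZ); apply: eq_psubst => w /=. Qed.

Lemma nest_r_eval op a nu rho p :
  G (nest_r op a nu rho p) =
  psubst (s rho) (fun w => psubst1 (s nu) (op a w)) p.
Proof.
by rewrite (psubst_semilinear GZ); apply: eq_psubst => w /=; rewrite psubst2_eval.
Qed.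

Lemma nest_l_eval op rho p nu c :
  G (nest_l op rho p nu c) =
  psubst (s rho) (fun w => psubst1 (s nu) (op w c)) p.
Proof.
by rewrite (psubst_semilinear GZ); apply: eq_psubst => w /=; rewrite psubst2_eval.
Qed.

End Evaluation.

(** The variable [lambda] is the inner one of [L[lambda][mu]], so [lambda = 0]
is imposed coefficientwise in [mu], and the remaining variable is [mu]. *)
Definition eval_lam0 : {additive L2 -> L1} :=
  @pmap Fdel1 {poly F} L1 L (mcoeff 0).

Definition scalar_lam0 : {rmorphism Fdel2 -> Fdel1} := map_poly (coefp 0).

Lemma eval_lam0Z k u : eval_lam0 (k *: u) = scalar_lam0 k *: eval_lam0 u.
Proof.
by rewrite /eval_lam0 /= (@pmapZ _ _ _ _ (coefp 0)) // => k0 v; exact: mcoeff0Z.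
Qed.

Lemma eval_lam0_const w : eval_lam0 (pconst (pconst w)) = pconst w.
Proof. by rewrite /eval_lam0 /= pmap_const /= /pconst mcoeffUU. Qed.

Lemma scalar_lam0_lam : scalar_lam0 (lam2 F) = 0.
Proof. by rewrite [LHS](map_polyC (coefp 0)) /= coefX polyC0. Qed.

Lemma scalar_lam0_mu : scalar_lam0 (mu2 F) = 'X.
Proof. exact: (map_polyX (coefp 0)). Qed.

Lemma eval_lam0_nest_l op q c : is_conformal op ->
  eval_lam0 (nest_l op (lam2 F) q (lam2 F + mu2 F) c) = op q@_0 c.
Proof.
move=> opC; rewrite (nest_l_eval eval_lam0Z eval_lam0_const) rmorphD.
rewrite scalar_lam0_lam scalar_lam0_mu add0r.
rewrite psubst_at0; first exact: psubst_var.
by rewrite (conformal_l0 _ opC) /psubst1 psubst_0.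
Qed.

Lemma eval_lam0_nest_r op a q : is_conformal op ->
  eval_lam0 (nest_r op a (mu2 F) (lam2 F) q) = op a q@_0.
Proof.
move=> opC; rewrite (nest_r_eval eval_lam0Z eval_lam0_const).
rewrite scalar_lam0_lam scalar_lam0_mu.
rewrite psubst_at0; first exact: psubst_var.
by rewrite (conformal_r0 _ opC) /psubst1 psubst_0.
Qed.

(** * Twisting a bracket by a linear map *)

Section Twist.
Context (H : {linear L -> L}).

(** A coefficientwise map on [L[lambda][mu]] is linear over the scalars
[F[del][lambda][mu]], so it commutes with nested products. *)
Definition pmap2 : L2 -> L2 := pmap (pmap H).
HB.instance Definition _ := GRing.Linear.on pmap2.

Lemma psubst2_pmap nu p : psubst2 nu (pmap H p) = pmap2 (psubst2 nu p).
Proof.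
rewrite [RHS]psubst_linear /psubst2 psubst_pmap; last by rewrite !raddf0.
by apply: eq_psubst => w /=; rewrite /pmap2 pmap_const /= pmap_const.
Qed.

Lemma psubst1_pmap (nu : Fdel1) p :
  psubst1 nu (pmap H p) = pmap H (psubst1 nu p).
Proof.
rewrite /psubst1 [LHS]psubst_pmap ?raddf0 // [RHS]psubst_linear.
by apply: eq_psubst => w /=; rewrite pmap_const.
Qed.

Context (br brH : L -> L -> L1).
Hypothesis brHE : forall x y, brH x y = pmap H (br x y).

Lemma nest_r_twist a nu rho p :
  nest_r brH a nu rho p = pmap2 (nest_r br a nu rho p).
Proof.
by rewrite psubst_linear; apply: eq_psubst => w /=; rewrite brHE psubst2_pmap.
Qed.

Lemma nest_l_twist rho p nu c :
  nest_l brH rho p nu c = pmap2 (nest_l br rho p nu c).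
Proof.
by rewrite psubst_linear; apply: eq_psubst => w /=; rewrite brHE psubst2_pmap.
Qed.

Lemma conformal_twist : is_conformal br -> is_conformal brH.
Proof.
move=> brC; split=> *; rewrite !brHE.
- by rewrite (conformalDl brC) raddfD.
- by rewrite (conformalDr brC) raddfD.
- by rewrite (conformalZl brC) linearZ.
- by rewrite (conformalZr brC) linearZ.
- by rewrite (conformal_dell brC) linearZ.
- by rewrite (conformal_delr brC) linearZ.
Qed.

Hypothesis brC : is_conformal br.
Hypothesis H_half_der :
  forall x y, pmap H (br x y) *+ 2 = br (H x) y + br x (H y).

(** The half-derivation rule lifts to one polynomial argument; the bracket
[br a] is then applied to every coefficient [w] of [p]. *)
Lemma pmap2_nest_r a nu rho p :
  pmap2 (nest_r br a nu rho p) *+ 2 =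
  nest_r br (H a) nu rho p + nest_r br a nu rho (pmap H p).
Proof.
rewrite /nest_r [X in _ = _ + X]psubst_pmap; last first.
  by rewrite (conformal_r0 _ brC) /psubst2 psubst_0.
rewrite psubst_linear mulr2n -[LHS]psubst_addl -[RHS]psubst_addl.
apply: eq_psubst => w /=.
by rewrite -psubst2_pmap -[LHS]psubst2D -[RHS]psubst2D -H_half_der mulr2n.
Qed.

Lemma pmap2_nest_l rho p nu c :
  pmap2 (nest_l br rho p nu c) *+ 2 =
  nest_l br rho (pmap H p) nu c + nest_l br rho p nu (H c).
Proof.
rewrite /nest_l [X in _ = X + _]psubst_pmap; last first.
  by rewrite (conformal_l0 _ brC) /psubst2 psubst_0.
rewrite psubst_linear mulr2n -[LHS]psubst_addl -[RHS]psubst_addl.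
apply: eq_psubst => w /=.
by rewrite -psubst2_pmap -[LHS]psubst2D -[RHS]psubst2D -H_half_der mulr2n.
Qed.

(** [H] is applied to the inner brackets only; one more application of [H] to
this identity gives the Jacobi identity of [pmap H (br x y)]. *)
Lemma twisted_Jacobi a b c :
    (forall a b c, nest_r br a (lam2 F) (mu2 F) (br b c) =
      nest_l br (lam2 F) (br a b) (lam2 F + mu2 F) c
      + nest_r br b (mu2 F) (lam2 F) (br a c)) ->
  nest_r br a (lam2 F) (mu2 F) (pmap H (br b c)) =
    nest_l br (lam2 F) (pmap H (br a b)) (lam2 F + mu2 F) c
    + nest_r br b (mu2 F) (lam2 F) (pmap H (br a c)).
Proof.
move=> Jacobi.
have nestr2 x nu rho y z : nest_r br x nu rho (pmap H (br y z)) *+ 2 =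
    nest_r br x nu rho (br (H y) z) + nest_r br x nu rho (br y (H z)).
  rewrite mulr2n -[LHS](nest_rD _ _ _ brC) -[RHS](nest_rD _ _ _ brC).
  by rewrite -H_half_der mulr2n.
have nestl2 rho nu x y z : nest_l br rho (pmap H (br x y)) nu z *+ 2 =
    nest_l br rho (br (H x) y) nu z + nest_l br rho (br x (H y)) nu z.
  rewrite mulr2n -[LHS](nest_lD _ _ _ brC) -[RHS](nest_lD _ _ _ brC).
  by rewrite -H_half_der mulr2n.
have pmap2J : pmap2 (nest_r br a (lam2 F) (mu2 F) (br b c)) =
    pmap2 (nest_l br (lam2 F) (br a b) (lam2 F + mu2 F) c)
    + pmap2 (nest_r br b (mu2 F) (lam2 F) (br a c)).
  by rewrite Jacobi; exact: raddfD.
exact: (half_derivation_cancel pmap2J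
  (pmap2_nest_r _ _ _ _) (pmap2_nest_l _ _ _ _) (pmap2_nest_r _ _ _ _)
  (nestr2 _ _ _ _ _) (nestl2 _ _ _ _ _) (nestr2 _ _ _ _ _)
  (Jacobi _ _ _) (Jacobi _ _ _) (Jacobi _ _ _)).
Qed.

End Twist.

(** [H] commutes with multiplications and is a half-derivation of the bracket;
these are the properties that keep a twist by [H] transposed Poisson. *)
Lemma TPCA_twist (H : {linear L -> L}) op br brH :
    (forall x y, brH x y = pmap H (br x y)) ->
    (forall x y, op x (H y) = pmap H (op x y)) ->
    (forall x y, pmap H (br x y) *+ 2 = br (H x) y + br x (H y)) ->
  is_TPCA op br -> is_TPCA op brH.
Proof.
move=> brHE opH brH2 [[opC opA opcomm] [brC skew Jacobi] compat].
split.
- exact: Build_is_comm_assoc_conformal opC opA opcomm.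
- split; first exact: conformal_twist brHE brC.
  + by move=> a b; rewrite (brHE b a) (brHE a b) skew raddfN psubst1_pmap.
  + move=> a b c.
    rewrite (nest_r_twist brHE a) (nest_r_twist brHE b) (nest_l_twist brHE).
    rewrite (brHE b c) (brHE a b) (brHE a c).
    by rewrite (twisted_Jacobi brC brH2 _ _ _ Jacobi); exact: raddfD.
- move=> a b c; rewrite (nest_r_twist brHE b) (nest_l_twist brHE).
  have -> : nest_r op a (lam2 F) (mu2 F) (brH b c) =
      pmap2 H (nest_r op a (lam2 F) (mu2 F) (br b c)).
    rewrite brHE [LHS]psubst_pmap; last first.
      by rewrite (conformal_r0 _ opC) /psubst2 psubst_0.
    rewrite [RHS]psubst_linear; apply: eq_psubst => w /=.
    by rewrite opH psubst2_pmap.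
  by rewrite -[LHS](linearZZ (pmap2 H)) compat; exact: raddfD.
Qed.

(** * Multiplication by an element at parameter zero *)

Section ZeroMode.
Context (op br : L -> L -> L1) (h : L).
Hypothesis TP : is_TPCA op br.
Let opC : is_conformal op := comm_assoc_conformal (TPCA_comm_assoc TP).

Definition zero_mode x : L := (op h x)@_0.

Fact zero_mode_additive : {morph zero_mode : x y / x + y}.
Proof. by move=> x y; rewrite /zero_mode (conformalDr opC) mcoeffD. Qed.

Fact zero_mode_scalable : scalable zero_mode.
Proof.
move=> P x; elim/poly_ind: P => [|P k IH].
  by rewrite !scale0r (morph_add0 zero_mode_additive).
have zero_mode_del y : zero_mode (del F *: y) = del F *: zero_mode y.
  by rewrite /zero_mode (conformal_delr opC) mcoeff0Z coefD coefC coefX addr0.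
have zero_mode_const y : zero_mode (k%:P *: y) = k%:P *: zero_mode y.
  by rewrite /zero_mode (conformalZr opC) mcoeff0Z coefC.
rewrite !scalerDl zero_mode_additive zero_mode_const; congr (_ + _).
by rewrite mulrC -!scalerA zero_mode_del IH.
Qed.

Definition zero_mode_linear : {linear L -> L} :=
  HB.pack zero_mode
    (GRing.isNmodMorphism.Build L L zero_mode
       (conj (morph_add0 zero_mode_additive) zero_mode_additive))
    (GRing.isScalable.Build {poly F} L L *:%R zero_mode zero_mode_scalable).

Lemma psubst_zero_mode q :
  psubst 'X (fun w => psubst1 0 (op h w)) q = pmap zero_mode_linear q.
Proof.
rewrite -[RHS]psubst_var [RHS]psubst_pmap ?raddf0 //.
by apply: eq_psubst => w; rewrite psubst1_at0.
Qed.

(** Here [mu], the outer variable, is set to zero, and [lambda] remains. *)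
Lemma bracket_byE x y : bracket_by op br h x y = pmap zero_mode_linear (br x y).
Proof.
rewrite /bracket_by psubst_at0 //.
rewrite (@nest_r_eval (coefp 0) (mcoeff 0)).
- by rewrite /= coefX coefC /= psubst_zero_mode.
- by move=> k u; exact: mcoeff0Z.
- by move=> w; exact: mcoeffUU.
Qed.

Lemma eval_lam0_mul_h q :
  eval_lam0 (nest_r op h (lam2 F) (mu2 F) q) = pmap zero_mode_linear q.
Proof.
rewrite (nest_r_eval eval_lam0Z eval_lam0_const).
by rewrite scalar_lam0_lam scalar_lam0_mu psubst_zero_mode.
Qed.

(** Associativity [h o_lambda (a o_mu b) = (h o_lambda a) o_(lambda + mu) b] at
[lambda = 0]. *)
Lemma op_zero_mode_l a b :
  op (zero_mode_linear a) b = pmap zero_mode_linear (op a b).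
Proof.
rewrite -eval_lam0_mul_h (conformalA (TPCA_comm_assoc TP)).
by rewrite (eval_lam0_nest_l _ _ opC).
Qed.

Lemma op_zero_mode_r a b :
  op a (zero_mode_linear b) = pmap zero_mode_linear (op a b).
Proof.
have opcomm := conformalC (TPCA_comm_assoc TP).
by rewrite opcomm op_zero_mode_l psubst1_pmap -opcomm.
Qed.

(** The compatibility axiom for [h], [b], [c] at [lambda = 0]. *)
Lemma br_zero_mode b c : pmap zero_mode_linear (br b c) *+ 2 =
  br (zero_mode_linear b) c + br b (zero_mode_linear c).
Proof.
have brC := Lie_conformal (TPCA_Lie TP).
rewrite -eval_lam0_mul_h.
rewrite -(eval_lam0_nest_r _ _ brC) -(eval_lam0_nest_l _ _ brC).
rewrite -[LHS](raddfMn eval_lam0) -[RHS](raddfD eval_lam0) -(TPCA_compat TP).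
by rewrite scaler_nat.
Qed.

End ZeroMode.

End Nesting.

Theorem proposition4p1 (R : realType) (L : lmodType {poly R[i]})
    (op br : L -> L -> polymod L) (h : L) :
  is_TPCA op br -> is_TPCA op (bracket_by op br h).
Proof.
move=> TP.
apply: (TPCA_twist (bracket_byE h TP) (op_zero_mode_r h TP) (br_zero_mode h TP)).
exact: TP.
Qed.
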